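(* Let $\mathcal{K},\mathcal{H}$ be complex Hilbert spaces and let $\phi:\mathfrak{B}(\mathcal{K})\to\mathfrak{B}(\mathcal{H})$ be a non-zero (bounded) positive linear map. Let $\xi\in\mathcal{K}$ and $x\in\mathcal{H}$ be unit vectors and $\lambda>0$ a number such that $\phi(\xi\xi^* )x=\lambda x$. Define bounded operators $B,C:\mathcal{K}\to\mathcal{H}$ by $B\eta=\lambda^{-1/2}\phi(\eta\xi^* )x$ and $C\eta=\lambda^{-1/2}\phi(\xi\overline{\eta}^* )x$ for $\eta\in\mathcal{K}$, and let $\psi(X)=BXB^*$ and $\chi(X)=CX^{\mathrm T}C^*$ for $X\in\mathfrak{B}(\mathcal{K})$. Then $\psi\leq\phi$ if and only if for any $\eta\in\mathcal{K}$ and $y\in\mathcal{H}$ $$|\langle y,\phi(\eta\xi^* )x\rangle|^2\leq\langle x,\phi(\xi\xi^* )x\rangle\langle y,\phi(\eta\eta^* )y\rangle.$$ Analogously, $\chi\leq\phi$ if and only if for any $\eta\in\mathcal{K}$ and $y\in\mathcal{H}$ $$|\langle y,\phi(\xi\eta^* )x\rangle|^2\leq\langle x,\phi(\xi\xi^* )x\rangle\langle y,\phi(\eta\eta^* )y\rangle.$$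
   Context: $\mathfrak{B}(\mathcal{K})$ denotes the bounded operators on $\mathcal{K}$. Inner products are linear in the second variable. For $\xi,\eta\in\mathcal{K}$, $\xi\eta^*$ is the operator $(\xi\eta^* )\tau=\langle\eta,\tau\rangle\xi$. A linear map is positive if it maps positive operators to positive operators; $\psi\leq\phi$ means that $\phi-\psi$ is a positive map. A fixed antilinear involution $\xi\mapsto\overline{\xi}$ on $\mathcal{K}$ is given, with $\overline{\overline{\xi}}=\xi$ and $\langle\overline{\xi},\overline{\eta}\rangle=\langle\eta,\xi\rangle$; the transpose of $X\in\mathfrak{B}(\mathcal{K})$ is $X^{\mathrm T}\xi=\overline{X^*\overline{\xi}}$. *)

(* Defs.v *)
From HB Require Import structures.
From mathcomp Require Import all_boot all_order all_algebra complex.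
From mathcomp Require Import mathcomp_extra boolp classical_sets functions.
From mathcomp Require Import reals topology normedtype.
From mathcomp Require Import ring lra.

Set Implicit Arguments.
Unset Strict Implicit.
Unset Printing Implicit Defensive.

Import Order.TTheory GRing.Theory Num.Theory.
Import numFieldNormedType.Exports.

Local Open Scope classical_set_scope.
Local Open Scope ring_scope.

(* Forms of the sesquilinear library are linear in the first argument and
   antilinear in the second; [inner] below exchanges the two. *)
HB.mixin Record CompleteNormedModule_isHilbert (R : realType) V
    & CompleteNormedModule R[i] V := {
  hform : {dot V for @Num.conj R[i]};
  hformE : forall u : V, `|u| ^+ 2 = hform u u
}.

#[short(type="hilbertType")]
HB.structure Definition Hilbert (R : realType) :=
  {V of CompleteNormedModule R[i] V & CompleteNormedModule_isHilbert R V}.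


Section BoundedOperators.
Variables (R : realType) (V W : normedModType R[i]).

Definition bounded_op (f : V -> W) : bool :=
  `[< linear f /\ exists M : R[i], forall v, `|f v| <= M * `|v| >].

Record bop := Bop { bop_fun :> V -> W; _ : bounded_op bop_fun }.

HB.instance Definition _ := [isSub for bop_fun].
HB.instance Definition _ := [Choice of bop by <:].

Lemma bounded_op_submod : submod_closed bounded_op.
Proof.
split.
  rewrite unfold_in; apply/asboolP; split.
    by move=> a u v; rewrite scaler0 addr0.
  by exists 0 => v; rewrite [X in `|X|]/(0 : W) normr0 mul0r.
move=> a f g; rewrite !unfold_in => /asboolP[fl [M fM]] /asboolP[gl [N gN]].
apply/asboolP; split.
  move=> b u v.
  suff: a *: f (b *: u + v) + g (b *: u + v) =
    b *: (a *: f u + g u) + (a *: f v + g v) by [].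
  by rewrite fl gl !scalerDr !scalerA (mulrC a b) addrACA.
exists (`|a| * M + N) => v; rewrite mulrDl -mulrA.
by rewrite (le_trans (ler_normD _ _))// lerD// normrZ ler_wpM2l.
Qed.

HB.instance Definition _ :=
  GRing.isSubmodClosed.Build R[i] (V -> W) bounded_op bounded_op_submod.
HB.instance Definition _ := [SubChoice_isSubLmodule of bop by <:].

Lemma bop_linear (f : bop) : linear f.
Proof. by case: f => f fP; have /asboolP[] := fP. Qed.

HB.instance Definition _ (f : bop) :=
  GRing.isLinear.Build R[i] V W _ (bop_fun f) (bop_linear f).

Lemma bop_bounded (f : bop) : exists M : R[i], forall v, `|f v| <= M * `|v|.
Proof. by case: f => f fP; have /asboolP[] := fP. Qed.

Lemma bopP (f g : bop) : f =1 g -> f = g.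
Proof. by move=> fg; apply/val_inj/funext. Qed.

(* The supremum is taken in R, whereas norms take their values in R[i]. *)
Definition opnorm (f : bop) : R :=
  sup [set complex.Re `|f v| | v in [set v : V | `|v| <= 1]].

Lemma ReE (x : R[i]) : 0 <= x -> (complex.Re x)%:C%C = x.
Proof. by case: x => a b; rewrite lecE/= => /andP[/eqP -> _]. Qed.

Lemma le_Re (x y : R[i]) : x <= y -> complex.Re x <= complex.Re y.
Proof. by rewrite lecE => /andP[]. Qed.

Lemma opnorm_has_sup (f : bop) :
  has_sup [set complex.Re `|f v| | v in [set v : V | `|v| <= 1]].
Proof.
split; first by exists (complex.Re `|f 0|); exists 0 => //=; rewrite normr0.
have [M fM] := bop_bounded f; exists (complex.Re `|M|) => _ [v /= v1 <-].
apply: (@le_Re _ `|M|); rewrite (le_trans (fM v))//.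
have Mr : M * `|v| \is Num.real by rewrite (ger0_real (le_trans _ (fM v))).
rewrite (le_trans (real_ler_norm Mr))// normrM normr_id.
by rewrite -[leRHS]mulr1 ler_wpM2l.
Qed.

Lemma opnorm_ge0 (f : bop) : 0 <= opnorm f.
Proof.
have [_ ub] := opnorm_has_sup f.
rewrite (@le_trans _ _ (complex.Re `|f 0|))//.
  by rewrite linear0 normr0.
by apply: ub_le_sup => //; exists 0 => //=; rewrite normr0.
Qed.

Lemma le_opnorm (f : bop) v : `|f v| <= (opnorm f)%:C%C * `|v|.
Proof.
have [->|v0] := eqVneq v 0; first by rewrite linear0 !normr0 mulr0.
have nv : 0 < `|v| by rewrite normr_gt0.
rewrite -ler_pdivrMr// mulrC -[`|v|^-1]ger0_norm ?invr_ge0//.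
rewrite -normrZ -linearZ -[leLHS]ReE// lecR.
have [_ ub] := opnorm_has_sup f.
apply: ub_le_sup => //; exists (`|v|^-1 *: v) => //=.
by rewrite normrZ ger0_norm ?invr_ge0// mulVf ?gt_eqF.
Qed.

Lemma opnorm_le (f : bop) (M : R) : 0 <= M ->
  (forall v, `|f v| <= M%:C%C * `|v|) -> opnorm f <= M.
Proof.
move=> M0 fM; have [ne _] := opnorm_has_sup f.
apply: ge_sup => // _ [v /= v1 <-]; rewrite -lecR ReE// (le_trans (fM v))//.
by rewrite -[leRHS]mulr1 ler_wpM2l// lecR.
Qed.

Let bnorm (f : bop) : R[i] := (opnorm f)%:C%C.

Let bnormD f g : bnorm (f + g) <= bnorm f + bnorm g.
Proof.
rewrite /bnorm -rmorphD lecR opnorm_le ?addr_ge0 ?opnorm_ge0// => v.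
by rewrite rmorphD/= mulrDl (le_trans (ler_normD _ _))// lerD// le_opnorm.
Qed.

Let bnormZ_le a f : bnorm (a *: f) <= `|a| * bnorm f.
Proof.
rewrite /bnorm -[`|a|]ReE// -rmorphM lecR.
have a0 : 0 <= complex.Re `|a| by exact: (@le_Re 0 `|a|).
rewrite opnorm_le ?mulr_ge0 ?opnorm_ge0// => v.
have -> : (complex.Re `|a| * opnorm f)%:C%C = `|a| * (opnorm f)%:C%C.
  by rewrite rmorphM; congr (_ * _); exact: ReE.
rewrite -mulrA.
by rewrite [(a *: f) v]/(a *: f v) normrZ ler_wpM2l// le_opnorm.
Qed.

Let bnormZ a f : bnorm (a *: f) = `|a| * bnorm f.
Proof.
have [->|a0] := eqVneq a 0.
  rewrite normr0 mul0r; apply/eqP; rewrite eq_le.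
  rewrite (le_trans (bnormZ_le _ _)) ?normr0 ?mul0r//=.
  by rewrite /bnorm lecR opnorm_ge0.
apply/eqP; rewrite eq_le bnormZ_le/=.
have na : 0 < `|a| by rewrite normr_gt0.
rewrite mulrC -ler_pdivlMr// mulrC -normfV.
by rewrite (le_trans _ (bnormZ_le _ _))// scalerA mulVf// scale1r.
Qed.

Let bnorm_eq0 f : bnorm f = 0 -> f = 0.
Proof.
move=> f0; apply: bopP => v; apply/eqP; rewrite -normr_le0.
by rewrite (le_trans (le_opnorm _ _))// -/(bnorm f) f0 mul0r.
Qed.

HB.instance Definition _ :=
  Lmodule_isNormed.Build R[i] bop bnormD bnormZ bnorm_eq0.

Lemma bop_normE (f : bop) : `|f| = (opnorm f)%:C%C.
Proof. by []. Qed.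

Lemma ler_bop (f : bop) v : `|f v| <= `|f| * `|v|.
Proof. exact: le_opnorm. Qed.

Lemma bop_ler (f : bop) (M : R[i]) : 0 <= M ->
  (forall v, `|f v| <= M * `|v|) -> `|f| <= M.
Proof.
move=> M0 fM; rewrite -(ReE M0) lecR opnorm_le// => [|v]; last by rewrite ReE.
exact: (@le_Re 0 M).
Qed.

End BoundedOperators.

Notation "''B' ( V , W )" := (bop V W) (format "''B' ( V ,  W )") : type_scope.
Notation "''B' ( V )" := (bop V V) (format "''B' ( V )") : type_scope.

Section Inner.
Variables (R : realType) (V : hilbertType R).
Implicit Types u v w : V.

Definition inner u v : R[i] := hform v u.

Lemma innerC u v : inner u v = Num.conj (inner v u).
Proof. by rewrite /inner hermC/= expr0 mul1r. Qed.

Lemma inner_linear u : linear_for *%R (inner u).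
Proof. by move=> a v w; rewrite /inner linearPl. Qed.

Lemma innerDr u v w : inner u (v + w) = inner u v + inner u w.
Proof. by rewrite /inner linearDl. Qed.

Lemma innerZr a u v : inner u (a *: v) = a * inner u v.
Proof. by rewrite /inner linearZl_LR. Qed.

Lemma innerDl u v w : inner (u + v) w = inner u w + inner v w.
Proof. by rewrite /inner linearDr. Qed.

Lemma innerZl a u v : inner (a *: u) v = Num.conj a * inner u v.
Proof. by rewrite /inner linearZr_LR. Qed.

Lemma innerNl u v : inner (- u) v = - inner u v.
Proof. by rewrite -scaleN1r innerZl rmorphN1 mulN1r. Qed.

Lemma innerNr u v : inner u (- v) = - inner u v.
Proof. by rewrite -scaleN1r innerZr mulN1r. Qed.

Lemma innerBl u v w : inner (u - v) w = inner u w - inner v w.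
Proof. by rewrite innerDl innerNl. Qed.

Lemma innerE u : inner u u = `|u| ^+ 2.
Proof. by rewrite hformE. Qed.

Lemma inner_inj u v : (forall w, inner u w = inner v w) -> u = v.
Proof.
move=> uv; apply/eqP; rewrite -subr_eq0 -normr_eq0 -sqrf_eq0 -innerE.
by rewrite innerBl uv subrr.
Qed.

Lemma ler_inner u v : `|inner u v| <= `|u| * `|v|.
Proof.
have [->|v0] := eqVneq v 0.
  by rewrite -[X in inner u X](scale0r 0) innerZr mul0r !normr0 mulr0.
have nv : 0 < `|v| by rewrite normr_gt0.
rewrite -ler_sqr ?nnegrE ?mulr_ge0// exprMn -subr_ge0.
rewrite -(pmulr_rge0 _ (exprn_gt0 2 nv)).
set c := inner v u.
suff -> : `|v| ^+ 2 * (`|u| ^+ 2 * `|v| ^+ 2 - `|inner u v| ^+ 2) =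
    `| `|v| ^+ 2 *: u - c *: v | ^+ 2 by rewrite exprn_ge0.
have nr : Num.conj `|v| = `|v| by rewrite conj_Creal ?normr_real.
rewrite -[RHS]innerE !(innerDl, innerNl, innerZl, innerDr, innerNr, innerZr).
rewrite !innerE rmorphXn/= nr (innerC u v) -/c normCK conjCK.
by ring.
Qed.

End Inner.

Section Riesz.
Variables (R : realType) (V : hilbertType R) (f : V -> R[i]).
Hypothesis fl : linear_for *%R f.
Hypothesis fb : exists M : R[i], forall v, `|f v| <= M * `|v|.
Local Notation conj := (@Num.conj R[i]).

Let fD u v : f (u + v) = f u + f v.
Proof. by rewrite -[u in LHS]scale1r fl mul1r. Qed.

Let f0 : f 0 = 0.
Proof. by apply: (addIr (f 0)); rewrite -fD !add0r. Qed.

Let fZ a u : f (a *: u) = a * f u.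
Proof. by rewrite -[a *: u]addr0 fl f0 addr0. Qed.

Let J v : R[i] := `|v| ^+ 2 - (f v + conj (f v)).
Let j v : R := complex.Re (J v).

Let jE v : (j v)%:C%C = J v.
Proof.
rewrite RRe_real// rpredB ?rpredX ?normr_real//.
by apply/CrealP; rewrite rmorphD/= conjCK addrC.
Qed.

Let j_lb : exists m : R, forall v, m <= j v.
Proof.
have [M fM] := fb; have M0 (v : V) : v != 0 -> 0 <= M.
  move=> v0; have nv : 0 < `|v| by rewrite normr_gt0.
  by rewrite -(pmulr_lge0 _ nv) (le_trans _ (fM v)).
exists (complex.Re (- `|M| ^+ 2)) => v; apply: le_Re; rewrite /J.
have [->|v0] := eqVneq v 0.
  by rewrite f0 conjC0 !addr0 normr0 expr0n/= oppr0 addr0 oppr_le0 exprn_ge0.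
have {}M0 := M0 _ v0.
have fv : f v + conj (f v) <= 2 * (`|M| * `|v|).
  rewrite mulr_natl mulr2n (ger0_norm M0) (le_trans _ (lerD (fM v) (fM v)))//.
  rewrite -[X in _ <= _ + X](norm_conjC (f v)).
  apply: le_trans (ler_normD _ _).
  by apply: real_ler_norm; apply/CrealP; rewrite rmorphD/= conjCK addrC.
rewrite -subr_ge0 (@le_trans _ _ ((`|v| - `|M|) ^+ 2))//.
  by rewrite real_exprn_even_ge0// rpredB ?normr_real.
rewrite -subr_ge0; move: fv; rewrite -subr_ge0.
by congr (0 <= _); ring.
Qed.

Let m := inf (range j).

Let m_lb v : m <= j v.
Proof.
have [l lj] := j_lb; apply: ge_inf; last by exists v.
by exists l => _ [w _ <-].
Qed.

Let S (e : R) := [set v | j v < m + e].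

Let S_neq0 e : 0 < e -> exists v, S e v.
Proof.
move=> e0; have [l lj] := j_lb.
have hi : has_inf (range j).
  by split; [exists (j 0), 0|exists l => _ [w _ <-]].
by have [_ [v _ <-] jv] := inf_adherent e0 hi; exists v.
Qed.

Let S_dist e u v : S e u -> S e v -> `|u - v| ^+ 2 < (4 * e)%:C%C.
Proof.
move=> Su Sv; have mw := m_lb (2^-1 *: (u + v)).
have -> : `|u - v| ^+ 2 = (2 * (j u + j v) - 4 * j (2^-1 *: (u + v)))%:C%C.
  rewrite rmorphB !rmorphM !rmorph_nat (rmorphD _ (j u))/= !jE.
  rewrite /J -!innerE fZ fD.
  rewrite !(innerDl, innerNl, innerZl, innerDr, innerNr, innerZr).
  rewrite rmorphM (rmorphD _ (f u))/= fmorphV !rmorph_nat.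
  by field.
by rewrite ltcR; move: Su Sv; rewrite /S/=; lra.
Qed.

Let S_grad e u v : S e u -> `|inner u v - f v| ^+ 2 <= e%:C%C * `|v| ^+ 2.
Proof.
move=> Su; set c := inner u v - f v.
have [v0|v0] := eqVneq v 0.
  rewrite /c v0 f0 -[X in inner u X](scale0r 0) innerZr mul0r subr0.
  by rewrite !normr0 expr0n mulr0.
have nv : 0 < `|v| by rewrite normr_gt0.
set s := `|v| ^- 2; set t := - (s * conj c).
have cs : conj s = s by rewrite /s fmorphV rmorphXn/= conj_Creal ?normr_real.
have ct : conj t = - (s * c).
  by rewrite /t rmorphN rmorphM /= conjCK cs.
have Jt : J (u + t *: v) = J u - `|c| ^+ 2 * s.
  rewrite /J -!innerE fD fZ.
  rewrite !(innerDl, innerNl, innerZl, innerDr, innerNr, innerZr).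
  rewrite (innerC v u) (innerE v).
  have -> : inner u v = c + f v by rewrite /c subrK.
  rewrite (rmorphD _ (f u)) (rmorphD _ c) (rmorphM _ t)/= ct.
  rewrite normCK /t /s.
  by field; rewrite gt_eqF.
have : m%:C%C <= J (u + t *: v) by rewrite -jE lecR.
rewrite Jt -jE => mj; rewrite -ler_pdivrMr ?exprn_gt0// -/s.
have : (j u)%:C%C < (m + e)%:C%C by rewrite ltcR.
rewrite rmorphD/= => ju.
apply: (@le_trans _ _ ((j u)%:C%C - m%:C%C)).
  by move: mj; rewrite !lerBrDr addrC.
by rewrite lerBlDl ltW.
Qed.

Lemma riesz : exists w, forall v, f v = inner w v.
Proof.
pose F : set_system V := filter_from [set e : R | 0 < e] S.
have FF : ProperFilter F.
  apply: filter_from_proper => [|e /= e0]; last exact: S_neq0.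
  apply: filter_from_filter; first by exists 1 => /=.
  move=> e1 e2 /= e10 e20; exists (Num.min e1 e2).
    by rewrite /= lt_min e10.
  move=> v; rewrite /S/= => jv.
  by split; apply: (lt_le_trans jv); rewrite lerD2l ge_min lexx ?orbT.
have : cauchy F.
  apply: cauchy_exP => eps eps0.
  have epsE := ReE (ltW eps0); set e := complex.Re eps in epsE.
  have e0 : 0 < e by rewrite -ltcR epsE.
  have e40 : 0 < e ^+ 2 / 4 by rewrite divr_gt0// exprn_gt0.
  have [x Sx] := S_neq0 e40; exists x; exists (e ^+ 2 / 4) => // y Sy.
  rewrite -ball_normE/= -(@ltr_pXn2r _ 2)// ?nnegrE ?(ltW eps0)//.
  apply: (lt_le_trans (S_dist Sx Sy)).
  by rewrite mulrC divfK ?pnatr_eq0// rmorphXn/= epsE.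
move=> /cauchy_cvg/cvg_ex[w Fw]; exists w => v.
have dw eps : 0 < eps -> `|f v - inner w v| <= eps%:C%C * (2 * `|v|).
  move=> eps0.
  have /fcvgrPdist_lt/(_ eps%:C%C) := Fw.
  rewrite ltcR => /(_ eps0) Fw'.
  have e20 : 0 < eps ^+ 2 by rewrite exprn_gt0.
  have FS : F (S (eps ^+ 2)) by exists (eps ^+ 2).
  have [u [/= wu Su]] := filter_ex (filterI Fw' FS).
  have -> : f v - inner w v = - (inner u v - f v) - inner (w - u) v.
    by rewrite innerBl; ring.
  rewrite (le_trans (ler_normB _ _))// normrN mulr_natl mulr2n mulrDr lerD//.
    rewrite -(@ler_pXn2r _ 2)// ?nnegrE//; last first.
      by rewrite mulr_ge0// lecR ltW.
    by have := S_grad v Su; rewrite rmorphXn exprMn.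
  by rewrite (le_trans (ler_inner _ _))// ler_wpM2r// ltW.
apply/eqP; rewrite -subr_eq0; apply/negPn/negP => d0.
have nd : 0 < `|f v - inner w v| by rewrite normr_gt0.
have n1 : 0 < 2 * `|v| + 1 by rewrite ltr_wpDl ?mulr_ge0.
set q := `|f v - inner w v| / (2 * `|v| + 1).
have q0 : 0 < q by rewrite divr_gt0.
have Rq0 : 0 < complex.Re q by rewrite -ltcR ReE// ltW.
have := dw _ Rq0; rewrite (ReE (ltW q0)).
rewrite /q mulrAC ler_pdivlMr// ler_pM2l//.
by rewrite -subr_ge0 opprD addNKr ?ler0N1.
Qed.

End Riesz.

Lemma bounded_opP (R : realType) (V W : normedModType R[i]) (f : V -> W) :
  linear f -> (exists M : R[i], forall v, `|f v| <= M * `|v|) -> bounded_op f.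
Proof. by move=> fl fb; apply/asboolP. Qed.

Section Composition.
Variables (R : realType) (U V W : normedModType R[i]).

Fact bop_comp_subproof (g : 'B(V, W)) (f : 'B(U, V)) : bounded_op (g \o f).
Proof.
apply: bounded_opP => [a u v|]; first by rewrite /= !linearP.
exists (`|g| * `|f|) => v /=; rewrite -mulrA (le_trans (ler_bop _ _))//.
by rewrite ler_wpM2l// ler_bop.
Qed.
Definition bop_comp g f : 'B(U, W) := Bop (bop_comp_subproof g f).

Lemma ler_bop_comp g f : `|bop_comp g f| <= `|g| * `|f|.
Proof.
apply: bop_ler => [|v]; first by rewrite mulr_ge0.
rewrite /= -mulrA (le_trans (ler_bop _ _))//.
by rewrite ler_wpM2l// ler_bop.
Qed.

End Composition.

Section Adjoint.
Variables (R : realType) (V W : hilbertType R).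

(* [adjointP] shows that the set below is not empty, hence a singleton. *)
Definition adjoint (A : 'B(V, W)) : 'B(W, V) :=
  xget 0 [set B : 'B(W, V) | forall y v, inner (B y) v = inner y (A v)].

Lemma adjointP A y v : inner (adjoint A y) v = inner y (A v).
Proof.
suff [B BA] : exists B : 'B(W, V), forall y v, inner (B y) v = inner y (A v).
  exact: (@xgetI _ 0 [set B : 'B(W, V) |
    forall y v, inner (B y) v = inner y (A v)] B BA).
have /choice[B BA] : forall y, exists w, forall v, inner w v = inner y (A v).
  move=> {v}y.
  have fl : linear_for *%R (fun v => inner y (A v)).
    by move=> a u v; rewrite linearP innerDr innerZr.
  have [|w wA] := riesz fl; last by exists w.
  exists (`|y| * `|A|) => u; rewrite -mulrA (le_trans (ler_inner _ _))//.
  by rewrite ler_wpM2l// ler_bop.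
have Bl : linear B.
  move=> a y1 y2; apply: inner_inj => w.
  by rewrite BA !(innerDl, innerZl) !BA.
suff Bb : exists M : R[i], forall y, `|B y| <= M * `|y|.
  by exists (Bop (bounded_opP Bl Bb)).
exists `|A| => z; have [->|Bz] := eqVneq (B z) 0.
  by rewrite normr0 mulr_ge0.
have nB : 0 < `|B z| by rewrite normr_gt0.
rewrite -(ler_pM2r nB) -[leLHS]expr2 -innerE BA.
have i0 : 0 <= inner z (A (B z)) by rewrite -BA innerE exprn_ge0.
rewrite -(ger0_norm i0) (le_trans (ler_inner _ _))//.
by rewrite [leRHS]mulrAC [leRHS]mulrC ler_wpM2l// ler_bop.
Qed.

Lemma ler_adjoint A : `|adjoint A| <= `|A|.
Proof.
apply: bop_ler => // z; have [->|Bz] := eqVneq (adjoint A z) 0.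
  by rewrite normr0 mulr_ge0.
have nB : 0 < `|adjoint A z| by rewrite normr_gt0.
rewrite -(ler_pM2r nB) -[leLHS]expr2 -innerE adjointP.
have i0 : 0 <= inner z (A (adjoint A z)) by rewrite -adjointP innerE exprn_ge0.
rewrite -(ger0_norm i0) (le_trans (ler_inner _ _))//.
by rewrite [leRHS]mulrAC [leRHS]mulrC ler_wpM2l// ler_bop.
Qed.

End Adjoint.

Section RankOne.
Variables (R : realType) (V : hilbertType R).
Implicit Types u v : V.

Fact rank1_subproof u v : bounded_op (fun w : V => inner v w *: u).
Proof.
apply: bounded_opP => [a w1 w2|].
  by rewrite innerDr innerZr scalerDl scalerA.
exists (`|v| * `|u|) => w; rewrite normrZ mulrAC ler_wpM2r//.
exact: ler_inner.
Qed.
(* The operator [u v^*]. *)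
Definition rank1 u v : 'B(V) := Bop (rank1_subproof u v).

Lemma ler_rank1 u v : `|rank1 u v| <= `|u| * `|v|.
Proof.
apply: bop_ler => [|w]; first by rewrite mulr_ge0.
by rewrite normrZ -mulrA mulrC ler_wpM2l// ler_inner.
Qed.

Lemma rank1_linearl v : linear (rank1 ^~ v).
Proof.
move=> a u1 u2; apply: bopP => w /=.
rewrite -[RHS]/(a *: (inner v w *: u1) + inner v w *: u2).
by rewrite scalerDr !scalerA mulrC.
Qed.

Lemma rank1_antilinearr u a v1 v2 :
  rank1 u (a *: v1 + v2) = Num.conj a *: rank1 u v1 + rank1 u v2.
Proof.
apply: bopP => w /=.
rewrite -[RHS]/(Num.conj a *: (inner v1 w *: u) + inner v2 w *: u).
by rewrite innerDl innerZl scalerDl scalerA.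
Qed.

End RankOne.

(* In R[i], [0 <= z] means that z is real and nonnegative. *)
Definition positive_op (R : realType) (V : hilbertType R) (X : 'B(V)) :=
  forall v, 0 <= inner v (X v).

Definition positive_map (R : realType) (V W : hilbertType R)
    (phi : 'B('B(V), 'B(W))) :=
  forall X : 'B(V), positive_op X -> positive_op (phi X).

Definition le_map (R : realType) (V W : hilbertType R)
    (psi phi : 'B('B(V), 'B(W))) :=
  positive_map (phi - psi).

Record conjugation (R : realType) (V : hilbertType R) := Conjugation {
  conj_fun :> V -> V;
  conj_antilinear : forall (a : R[i]) u v,
    conj_fun (a *: u + v) = Num.conj a *: conj_fun u + conj_fun v;
  conj_involutive : involutive conj_fun;
  conj_inner : forall u v, inner (conj_fun u) (conj_fun v) = inner v u
}.

Section Transpose.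
Variables (R : realType) (V : hilbertType R) (J : conjugation V).

Lemma conj_norm u : `|J u| = `|u|.
Proof.
by apply/eqP; rewrite -(@eqrXn2 _ 2)// -!innerE conj_inner.
Qed.

Fact transpose_subproof (X : 'B(V)) :
  bounded_op (fun v => J (adjoint X (J v))).
Proof.
apply: bounded_opP => [a u v|].
  by rewrite conj_antilinear linearP conj_antilinear conjCK.
exists `|adjoint X| => v; rewrite conj_norm (le_trans (ler_bop _ _))//.
by rewrite conj_norm.
Qed.
(* X^T v = J (X^* (J v)) *)
Definition transpose (X : 'B(V)) : 'B(V) := Bop (transpose_subproof X).

Lemma ler_transpose X : `|transpose X| <= `|X|.
Proof.
apply: bop_ler => // v; rewrite /= conj_norm (le_trans (ler_bop _ _))//.
by rewrite conj_norm ler_wpM2r// ler_adjoint.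
Qed.

Lemma transpose_linear : linear transpose.
Proof.
move=> a X Y; apply: bopP => v.
rewrite -[RHS]/(a *: J (adjoint X (J v)) + J (adjoint Y (J v))).
rewrite -[a]conjCK -conj_antilinear /=; congr (J _).
apply: inner_inj => w; rewrite conjCK innerDl innerZl conjCK !adjointP.
by rewrite -innerZr -innerDr.
Qed.

End Transpose.

Section ConjugationMaps.
Variables (R : realType) (K H : hilbertType R).

Fact psi_map_subproof (B : 'B(K, H)) :
  bounded_op (fun X : 'B(K) => bop_comp B (bop_comp X (adjoint B))).
Proof.
apply: bounded_opP => [a X Y|].
  apply: bopP => v /=.
  rewrite -[RHS]/(a *: B (X (adjoint B v)) + B (Y (adjoint B v))).
  by rewrite -linearP.
exists (`|B| * `|adjoint B|) => X; rewrite (le_trans (ler_bop_comp _ _))//.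
by rewrite -mulrA ler_wpM2l// mulrC ler_bop_comp.
Qed.
(* X |-> B X B^* *)
Definition psi_map B : 'B('B(K), 'B(H)) := Bop (psi_map_subproof B).

Fact chi_map_subproof (J : conjugation K) (C : 'B(K, H)) :
  bounded_op
    (fun X : 'B(K) => bop_comp C (bop_comp (transpose J X) (adjoint C))).
Proof.
apply: bounded_opP => [a X Y|].
  by rewrite transpose_linear -[LHS]/(psi_map C _) linearP.
exists (`|C| * `|adjoint C|) => X; rewrite (le_trans (ler_bop_comp _ _))//.
rewrite -mulrA ler_wpM2l// mulrC (le_trans (ler_bop_comp _ _))//.
by rewrite ler_wpM2r// ler_transpose.
Qed.
(* X |-> C X^T C^* *)
Definition chi_map J C : 'B('B(K), 'B(H)) := Bop (chi_map_subproof J C).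

Variables (phi : 'B('B(K), 'B(H))) (xi : K) (x : H) (lam : R).

Fact opB_subproof :
  bounded_op (fun eta : K => (Num.sqrt lam)^-1%:C%C *: phi (rank1 eta xi) x).
Proof.
apply: bounded_opP => [a u v|].
  rewrite rank1_linearl linearP.
  rewrite -[in LHS]/(a *: phi (rank1 u xi) x + phi (rank1 v xi) x).
  by rewrite scalerDr !scalerA mulrC.
exists (`|(Num.sqrt lam)^-1%:C%C| * (`|phi| * `|xi| * `|x|)) => v.
rewrite normrZ -[leRHS]mulrA ler_wpM2l// (le_trans (ler_bop _ _))//.
rewrite [leRHS]mulrAC ler_wpM2r// (le_trans (ler_bop _ _))//.
by rewrite -mulrA ler_wpM2l// mulrC ler_rank1.
Qed.
(* B eta = lam ^ (-1/2) phi (eta xi^* ) x *)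
Definition opB : 'B(K, H) := Bop opB_subproof.

Fact opC_subproof (J : conjugation K) :
  bounded_op
    (fun eta : K => (Num.sqrt lam)^-1%:C%C *: phi (rank1 xi (J eta)) x).
Proof.
apply: bounded_opP => [a u v|].
  rewrite conj_antilinear rank1_antilinearr conjCK linearP.
  rewrite -[in LHS]/(a *: phi (rank1 xi (J u)) x + phi (rank1 xi (J v)) x).
  by rewrite scalerDr !scalerA mulrC.
exists (`|(Num.sqrt lam)^-1%:C%C| * (`|phi| * `|xi| * `|x|)) => v.
rewrite normrZ -[leRHS]mulrA ler_wpM2l// (le_trans (ler_bop _ _))//.
rewrite [leRHS]mulrAC ler_wpM2r// (le_trans (ler_bop _ _))//.
by rewrite -mulrA ler_wpM2l// (le_trans (ler_rank1 _ _))// conj_norm.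
Qed.
(* C eta = lam ^ (-1/2) phi (xi (J eta)^* ) x, where J eta is the conjugate of
   eta *)
Definition opC (J : conjugation K) : 'B(K, H) := Bop (opC_subproof J).

End ConjugationMaps.

(* Main.v *)
Require Import Defs.
From mathcomp Require Import all_boot all_order all_algebra complex.
From mathcomp Require Import reals normedtype.
From mathcomp Require Import ring.

(** The inequality [psi <= phi] asserts [<w, X w> <= <y, phi X y>] for all [y]
    and all [X >= 0], where [w = B^* y].  For [X = eta eta^*] the left side is
    [|<eta, w>|^2 = lam^-1 |<y, phi (eta xi^* ) x>|^2], and
    [lam = <x, phi (xi xi^* ) x>], so the displayed inequality is exactly the
    restriction of [psi <= phi] to rank-one operators.

    The converse passes from rank-one operators to all positive [X], although
    a bounded positive [phi] need not be normal, so that approximating [X] by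
    finite-rank operators gives no control over [phi X].  Instead, for given
    [X] and [w], a single rank-one operator suffices: by the Cauchy-Schwarz inequality for the
    form [<_, X _>] one has [(X w)(X w)^* <= s X] with [s = <w, X w>]
    ([rank1_le_scale_positive]), while both sides have the same value [s ^ 2] in
    the vector state [w].  Applying [phi] and the rank-one inequality gives
    [s ^ 2 <= <y, phi ((X w)(X w)^* ) y> <= s <y, phi X y>], and it remains to
    divide by [s] ([le_vector_state_rank1]); for [s = 0] the inequality is the
    positivity of [phi X].

    For [chi] the same argument applies with [w = J (C^* y)], because
    [<v, X^T v> = <J v, X (J v)>]. *)

Set Implicit Arguments.
Unset Strict Implicit.
Unset Printing Implicit Defensive.

Import Order.TTheory GRing.Theory Num.Theory.

Local Open Scope ring_scope.

Section PositiveOperators.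
Variables (R : realType) (V : hilbertType R).
Implicit Types (u v w : V) (X : 'B(V)).

Lemma normr_innerC u v : `|inner u v| = `|inner v u|.
Proof. by rewrite innerC norm_conjC. Qed.

Lemma inner_rank1 u v : inner v (rank1 u u v) = `|inner u v| ^+ 2.
Proof. by rewrite /= innerZr normCK -innerC. Qed.

Lemma rank1_positive u : positive_op (rank1 u u).
Proof. by move=> v; rewrite inner_rank1 exprn_ge0. Qed.

Lemma inner_polar X (a : R[i]) u v :
  inner (u + a *: v) (X (u + a *: v)) =
  inner u (X u) + (a * inner u (X v) + Num.conj a * inner v (X u)) +
  Num.conj a * a * inner v (X v).
Proof.
by rewrite linearD linearZ !(innerDl, innerZl, innerDr, innerZr)/=; ring.
Qed.

(** Positivity only speaks of the diagonal of the form; over the complex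
    numbers, polarization recovers its symmetry: with [a = <u, X v>] and
    [b = <v, X u>], both [a + b] and [i (a - b)] are real, which forces [b] to
    be the conjugate of [a]. *)
Lemma positive_op_hermitian X u v : positive_op X ->
  inner v (X u) = Num.conj (inner u (X v)).
Proof.
move=> Xpos.
have cross (c : R[i]) :
    Num.conj (c * inner u (X v) + Num.conj c * inner v (X u)) =
    c * inner u (X v) + Num.conj c * inner v (X u).
  apply/CrealP.
  have -> : c * inner u (X v) + Num.conj c * inner v (X u) =
      inner (u + c *: v) (X (u + c *: v)) - inner u (X u) -
      Num.conj c * c * inner v (X v).
    by rewrite inner_polar; ring.
  rewrite (mulrC (Num.conj c) c) -normCK.
  by rewrite !(rpredB, rpredM)// ?rpredX// ger0_real.
set a := inner u (X v) in cross *; set b := inner v (X u) in cross *.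
have h1 : Num.conj a + Num.conj b = a + b.
  by have := cross 1; rewrite rmorph1 !mul1r rmorphD.
have h2 : - 'i * Num.conj a + 'i * Num.conj b = 'i * a + - 'i * b.
  have := cross 'i; rewrite conjCi => <-.
  by rewrite rmorphD !rmorphM rmorphN/= conjCi opprK.
have ab : a - b = Num.conj b - Num.conj a.
  apply: (mulfI (neq0Ci R[i])).
  transitivity ('i * a + - 'i * b); first by ring.
  by rewrite -h2; ring.
have b2 : b * 2 = Num.conj a * 2.
  transitivity ((a + b) - (a - b)); first by ring.
  by rewrite -h1 ab; ring.
by apply: (mulIf _ b2); rewrite pnatr_eq0.
Qed.

Lemma positive_op_cauchy_schwarz X u v : positive_op X ->
  0 < inner u (X u) ->
  `|inner (X u) v| ^+ 2 <= inner u (X u) * inner v (X v).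
Proof.
move=> Xpos s0; set s := inner u (X u).
have sr : Num.conj s = s by rewrite conj_Creal// gtr0_real.
rewrite normr_innerC; set c := inner v (X u).
(* The vector below minimizes the quadratic form on the line
   through [v] in the direction [u]. *)
have := Xpos (v + (- (Num.conj c / s)) *: u).
rewrite inner_polar -/c -/s (positive_op_hermitian v u Xpos) -/c.
rewrite !(rmorphN, rmorphM, fmorphV, conjCK)/= sr.
set q := (X in 0 <= X) => q0.
rewrite -subr_ge0.
suff -> : s * inner v (X v) - `|c| ^+ 2 = s * q by rewrite mulr_ge0// ltW.
by rewrite /q normCK; field; rewrite gt_eqF.
Qed.

(** The rank-one operator [(X w)(X w)^*] takes in the vector state [w] the same
    value as [s X], so this domination is sharp at [w]. *)
Lemma rank1_le_scale_positive X w : positive_op X -> 0 < inner w (X w) ->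
  positive_op (inner w (X w) *: X - rank1 (X w) (X w)).
Proof.
move=> Xpos s0 v.
rewrite -[X in inner v X]/(inner w (X w) *: X v - rank1 (X w) (X w) v).
rewrite innerDr innerNr innerZr inner_rank1 subr_ge0.
exact: positive_op_cauchy_schwarz.
Qed.

Lemma inner_transpose (J : conjugation V) X v :
  inner v (transpose J X v) = inner (J v) (X (J v)).
Proof. by rewrite /= -{1}[v](conj_involutive J) conj_inner adjointP. Qed.

End PositiveOperators.

Section PositiveMaps.
Variables (R : realType) (K H : hilbertType R).
Variable phi : 'B('B(K), 'B(H)).
Hypothesis phi_pos : positive_map phi.

(** The operator [(X w)(X w)^*] bridges the two sides: its image under [phi] is
    at most [<w, X w> phi X], and the rank-one inequality at [eta = X w] bounds
    the expectation of that image in [y] from below by [<w, X w> ^ 2]. *)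
Lemma le_vector_state_rank1 (w : K) (y : H) :
  (forall X, positive_op X -> inner w (X w) <= inner y (phi X y)) <->
  (forall eta, `|inner eta w| ^+ 2 <= inner y (phi (rank1 eta eta) y)).
Proof.
split=> [le_all eta|le_rank1 X Xpos].
  by rewrite -inner_rank1; apply/le_all/rank1_positive.
have := Xpos w; rewrite le_eqVlt => /predU1P[<-|s0]; first exact: phi_pos.
rewrite -(ler_pM2l s0).
have := phi_pos (rank1_le_scale_positive Xpos s0) y.
rewrite linearB linearZ/=.
rewrite -[X in inner y X]/(inner w (X w) *: phi X y
  - phi (rank1 (X w) (X w)) y) innerDr innerNr innerZr subr_ge0.
apply: le_trans; apply: le_trans (le_rank1 (X w)).
by rewrite normr_innerC (gtr0_norm s0) expr2.
Qed.

(** The map [f] stands for [B^*] in the case of [psi] and for the antilinear map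
    [J C^*] in the case of [chi], which is why it is a bare function. *)
Lemma le_map_rank1 (psi : 'B('B(K), 'B(H))) (f : H -> K) :
  (forall X y, inner y (psi X y) = inner (f y) (X (f y))) ->
  le_map psi phi <->
  (forall eta y, `|inner eta (f y)| ^+ 2 <= inner y (phi (rank1 eta eta) y)).
Proof.
move=> psiE.
have subE X y : inner y ((phi - psi) X y) =
    inner y (phi X y) - inner (f y) (X (f y)).
  rewrite -[X in inner y X]/(phi X y - psi X y).
  by rewrite innerDr innerNr psiE.
split=> [le_psi eta y|le_rank1 X Xpos y].
  apply: (proj1 (le_vector_state_rank1 (f y) y)) => X Xpos.
  by rewrite -subr_ge0 -subE; apply: le_psi.
rewrite subE subr_ge0.
exact: (proj2 (le_vector_state_rank1 (f y) y)).
Qed.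

End PositiveMaps.

Lemma normr_scale_sqrtV (R : realType) (lam : R) (z : R[i]) : 0 < lam ->
  `|(Num.sqrt lam)^-1%:C%C * z| ^+ 2 = lam%:C%C^-1 * `|z| ^+ 2.
Proof.
move=> lam0; rewrite normrM exprMn; congr (_ * _).
have s0 : 0 <= (Num.sqrt lam)^-1%:C%C by rewrite lecR invr_ge0 sqrtr_ge0.
by rewrite ger0_norm// -rmorphXn/= exprVn sqr_sqrtr ?ltW// fmorphV.
Qed.

Theorem theorem3p2 (R : realType) (K H : hilbertType R) (J : conjugation K)
    (phi : 'B('B(K), 'B(H))) (xi : K) (x : H) (lam : R)
    (phi_neq0 : phi != 0) (phi_pos : positive_map phi)
    (xi_unit : `|xi| = 1) (x_unit : `|x| = 1) (lam_gt0 : 0 < lam)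
    (eig : phi (rank1 xi xi) x = lam%:C%C *: x) :
  let B : 'B(K, H) := opB phi xi x lam in
  let C : 'B(K, H) := opC phi xi x lam J in
  let psi : 'B('B(K), 'B(H)) := psi_map B in
  let chi : 'B('B(K), 'B(H)) := chi_map J C in
  (le_map psi phi <->
   forall (eta : K) (y : H),
     `|inner y (phi (rank1 eta xi) x)| ^+ 2 <=
     inner x (phi (rank1 xi xi) x) * inner y (phi (rank1 eta eta) y)) /\
  (le_map chi phi <->
   forall (eta : K) (y : H),
     `|inner y (phi (rank1 xi eta) x)| ^+ 2 <=
     inner x (phi (rank1 xi xi) x) * inner y (phi (rank1 eta eta) y)).
Proof.
move=> B C psi chi.
have lamC : 0 < lam%:C%C :> R[i] by rewrite ltcR.
have -> : inner x (phi (rank1 xi xi) x) = lam%:C%C.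
  by rewrite eig innerZr innerE x_unit expr1n mulr1.
have psiE X y : inner y (psi X y) = inner (adjoint B y) (X (adjoint B y)).
  by rewrite adjointP.
have chiE X y : inner y (chi X y) =
    inner (J (adjoint C y)) (X (J (adjoint C y))).
  by rewrite -inner_transpose adjointP.
have innerBadj eta y : `|inner eta (adjoint B y)| ^+ 2 =
    lam%:C%C^-1 * `|inner y (phi (rank1 eta xi) x)| ^+ 2.
  by rewrite normr_innerC adjointP innerZr normr_scale_sqrtV.
have innerCadj eta y : `|inner eta (J (adjoint C y))| ^+ 2 =
    lam%:C%C^-1 * `|inner y (phi (rank1 xi eta) x)| ^+ 2.
  rewrite -{1}[eta](conj_involutive J) conj_inner adjointP innerZr.
  by rewrite conj_involutive normr_scale_sqrtV.
rewrite (le_map_rank1 phi_pos psiE) (le_map_rank1 phi_pos chiE).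
by split; split=> le_phi eta y; have := le_phi eta y;
  rewrite ?innerBadj ?innerCadj ler_pdivrMl.
Qed.
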